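(* Consider the price-and-quality competition game described in the context, with the cost functional satisfying (C1)–(C3) and with primitives $(\sigma,G,\bar p,C)$ not depending on $n$. For each $n\ge2$ let $(F_n,p_n)\in\mathcal F\times P$ be a symmetric equilibrium of the $n$-firm game, and let $\underline q_n=\inf\operatorname{supp}(dF_n)$ and $\bar q_n=\sup\operatorname{supp}(dF_n)$. Then: 1. If $p_n\to0$ as $n\to\infty$, then $c_{F_n}(\bar q_n)-c_{F_n}(\underline q_n)\to0$. 2. If, moreover, there exists $\kappa>0$ such that $c_F(y)-c_F(x)\ge\kappa(y-x)$ for all $F\in\mathcal F$ and all $0\le x<y\le1$, then $p_n\to0$ implies $\bar q_n-\underline q_n\to0$.
   Context: Let $X=[0,1]$ and $P=[0,\bar p]$ with $\bar p>0$. $\mathcal F$ is the set of cdfs on $X$ (right-continuous nondecreasing $F:[0,1]\to[0,1]$ with $F(1)=1$), with induced probability measures $dF$ ($dF([0,x])=F(x)$) and the topology of weak convergence of these measures. Game with $n$ firms: each firm $i$ chooses a quality distribution $F_i\in\mathcal F$ and a price $p_i\in P$ (marginal cost is $0$). Quality $Q_i\sim dF_i$ and taste shock $\varepsilon_i\sim G$ are drawn independently across and within firms, where $G$ is a cdf on $[0,1]$ with a continuous density $g$; fix $\sigma\in(0,1)$ and let $\hat Q_i=(1-\sigma)Q_i+\sigma\varepsilon_i$. The consumer buys from the firm maximizing $\hat Q_i-p_i$ (ties broken uniformly). Firm $i$'s payoff is $p_i$ times its probability of selling minus $C(F_i)$. For $F\in\mathcal F$ let $\hat F$ be the cdf of $\hat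 Q=(1-\sigma)Q+\sigma\varepsilon$ with $Q\sim dF$, $\varepsilon\sim G$ independent, extended by $0$ below $0$ and by $1$ above $1$. If all $n-1$ opponents play $(F,p)$, a firm playing $(H,r)$ gets $\int_X a_{F,p}(q;r)\,dH(q)-C(H)$, where $a_{F,p}(q;r)=r\int_0^1\hat F\left((1-\sigma)q+\sigma e+p-r\right)^{n-1}dG(e)$. $(F,p)$ is a symmetric equilibrium if $(H,r)=(F,p)$ maximizes this over $\mathcal F\times P$. The cost $C:\mathcal F\to\mathbb R$ satisfies: (C1) $C$ is convex and weakly continuous; (C2) for each $F\in\mathcal F$ there is a continuous $c_F:X\to\mathbb R$ such that for all $H\in\mathcal F$ the limit $\lim_{\varepsilon\downarrow0}\varepsilon^{-1}[C((1-\varepsilon)F+\varepsilon H)-C(F)]$ exists and equals $\int_Xc_F\,d(H-F)$; (C3) there is $\eta_1>0$ with $c_F(1)\ge c_F(0)+\bar\pi+\eta_1$ for all $F\in\mathcal F$, where $\bar\pi$ is an upper bound on gross payoffs (gross profits lie in $[0,\bar p]$, so $\bar\pi=\bar p$). *)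

(* Defs.v *)
From HB Require Import structures.
From mathcomp Require Import all_boot all_order all_algebra.
From mathcomp Require Import all_classical all_reals all_analysis.
From mathcomp Require Import measurable_realfun.

Set Implicit Arguments.
Unset Strict Implicit.
Unset Printing Implicit Defensive.

Import Order.TTheory GRing.Theory Num.Theory.
Import numFieldNormedType.Exports.

Local Open Scope classical_set_scope.
Local Open Scope ring_scope.

(* A cdf F : [0,1] -> [0,1] is represented by its extension to R by 0 on
   ]-oo, 0[ and by 1 on ]1, +oo[; F 0 may be positive (an atom at 0). *)
Record cdf01 (R : realType) := Cdf01 {
  cdf01_fun :> R -> R ;
  cdf01_nd : nondecreasing cdf01_fun ;
  cdf01_rc : right_continuous cdf01_fun ;
  cdf01_lt0 : forall x, x < 0 -> cdf01_fun x = 0 ;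
  cdf01_ge1 : forall x, 1 <= x -> cdf01_fun x = 1 }.

Section cdf01_measure.
Context {R : realType}.

HB.instance Definition _ (F : cdf01 R) :=
  isCumulative.Build R _ R (cdf01_fun F) (@cdf01_nd R F) (@cdf01_rc R F).

Lemma cdf01_Ny (F : cdf01 R) : cdf01_fun F @ -oo --> (0 : R).
Proof.
apply: cvg_near_cst; near=> x; apply: cdf01_lt0.
by near: x; exact: nbhs_ninfty_lt.
Unshelve. all: by end_near. Qed.

Lemma cdf01_y (F : cdf01 R) : cdf01_fun F @ +oo --> (1 : R).
Proof.
apply: cvg_near_cst; near=> x; apply: cdf01_ge1.
by near: x; exact: nbhs_pinfty_ge.
Unshelve. all: by end_near. Qed.

HB.instance Definition _ (F : cdf01 R) :=
  isCumulativeBounded.Build R 0 1 (cdf01_fun F) (cdf01_Ny F) (cdf01_y F).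

Definition dcdf (F : cdf01 R) : probability (measurableTypeR R) R :=
  lebesgue_stieltjes_measure (cdf01_fun F).

(* The integral over X = [0,1] with respect to dF. *)
Definition int01 (F : cdf01 R) (f : R -> R) : R :=
  \int[dcdf F]_(x in `[0%R, 1%R]%classic) f x.

End cdf01_measure.

Section weak_topology.
Context {R : realType}.

(* Continuous functions on X = [0,1]; their values outside [0,1] are never
   used. *)
Definition test_fun : Type :=
  {f : R -> R | {within `[0%R, 1%R]%classic, continuous f}}.

(* cdf01 carries the topology of weak convergence of the measures dF: the
   coarsest one making F |-> \int_X f dF continuous for all continuous f. *)
Definition weak_eval (F : cdf01 R) : {ptws test_fun -> R} :=
  fun f => int01 F (sval f).

HB.instance Definition _ := gen_eqMixin (cdf01 R).
HB.instance Definition _ := gen_choiceMixin (cdf01 R).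
HB.instance Definition _ :=
  Topological.copy (cdf01 R) (initial_topology weak_eval).

End weak_topology.

Section mixture.
Context {R : realType}.
Variables (F H : cdf01 R) (t : R).

(* The weight is projected to [0,1] so that the mixture is a cdf for every real
   t; only 0 <= t <= 1 matters. *)
Definition mix_weight : R := Num.max 0 (Num.min 1 t).

Definition mix_fun (x : R) : R :=
  (1 - mix_weight) * F x + mix_weight * H x.

Lemma mix_weight_ge0 : 0 <= mix_weight. Proof. by rewrite /mix_weight le_max lexx. Qed.
Lemma mix_weight_le1 : 0 <= 1 - mix_weight.
Proof. by rewrite subr_ge0 /mix_weight ge_max ler01 ge_min lexx. Qed.

Lemma mix_nd : nondecreasing mix_fun.
Proof.
by move=> x y xy; rewrite lerD// ler_wpM2l ?mix_weight_ge0 ?mix_weight_le1//; exact: cdf01_nd.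
Qed.

Lemma mix_rc : right_continuous mix_fun.
Proof. by move=> x; apply: cvgD; apply: cvgMl_tmp; exact: cdf01_rc. Qed.

Lemma mix_lt0 x : x < 0 -> mix_fun x = 0.
Proof. by move=> x0; rewrite /mix_fun !cdf01_lt0// !mulr0 addr0. Qed.

Lemma mix_ge1 x : 1 <= x -> mix_fun x = 1.
Proof. by move=> x1; rewrite /mix_fun !cdf01_ge1// !mulr1 subrK. Qed.

Definition mix : cdf01 R := Cdf01 mix_nd mix_rc mix_lt0 mix_ge1.

End mixture.

Section cost.
Context {R : realType}.
Variables (C : cdf01 R -> R) (c : cdf01 R -> R -> R).

Definition cost_convex := forall (F H : cdf01 R) (t : R), 0 <= t <= 1 ->
  C (mix F H t) <= (1 - t) * C F + t * C H.

Definition cost_gateaux := forall F : cdf01 R,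
  {within `[0%R, 1%R]%classic, continuous (c F)} /\
  forall H : cdf01 R,
    (e^-1 * (C (mix F H e) - C F)) @[e --> (0 : R)^'+]
      --> int01 H (c F) - int01 F (c F).

(* Gross profits lie in [0, pbar], so pbar is the upper bound on them. *)
Definition cost_steep (pbar : R) := exists2 eta : R, 0 < eta &
  forall F : cdf01 R, c F 0 + pbar + eta <= c F 1.

End cost.

Section game.
Context {R : realType}.

Definition has_continuous_density (G : cdf01 R) := exists g : R -> R,
  [/\ {within `[0%R, 1%R]%classic, continuous g},
      forall x, x \in `[0%R, 1%R] -> 0 <= g x &
      forall x, x \in `[0%R, 1%R] ->
        G x = \int[lebesgue_measure]_(t in `[0%R, x]%classic) g t].

Definition perceived (sigma : R) (qe : measurableTypeR R * measurableTypeR R)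
  : R := (1 - sigma) * qe.1 + sigma * qe.2.

Lemma measurable_perceived sigma : measurable_fun setT (perceived sigma).
Proof.
apply: measurable_funD; apply: measurable_funM => //.
Qed.

HB.instance Definition _ (sigma : R) :=
  isMeasurableFun.Build _ _ _ _ (perceived sigma) (measurable_perceived sigma).

(* The product measure encodes independence of quality and taste shock. *)
Definition hatF (sigma : R) (G F : cdf01 R) (z : R) : R :=
  fine (cdf (perceived sigma : {RV (dcdf F \x dcdf G)%E >-> R}) z).

Definition sale_value (sigma : R) (G : cdf01 R) (n : nat) (F : cdf01 R)
    (p q r : R) : R :=
  r * int01 G (fun e =>
    hatF sigma G F ((1 - sigma) * q + sigma * e + p - r) ^+ n.-1).

(* Payoff of a firm playing (H, r) when its n.-1 opponents all play (F, p). *)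
Definition payoff (sigma : R) (G : cdf01 R) (C : cdf01 R -> R) (n : nat)
    (F : cdf01 R) (p : R) (H : cdf01 R) (r : R) : R :=
  int01 H (fun q => sale_value sigma G n F p q r) - C H.

Definition symmetric_equilibrium (sigma : R) (G : cdf01 R) (pbar : R)
    (C : cdf01 R -> R) (n : nat) (F : cdf01 R) (p : R) :=
  p \in `[0%R, pbar] /\
  forall (H : cdf01 R) (r : R), r \in `[0%R, pbar] ->
    payoff sigma G C n F p H r <= payoff sigma G C n F p F p.

End game.

Section support.
Context {R : realType}.

Definition supp (F : cdf01 R) : set R :=
  [set x | forall U : set R, open U -> U x -> (0 < dcdf F U)%E].

Definition supp_low (F : cdf01 R) : R := inf (supp F).
Definition supp_high (F : cdf01 R) : R := sup (supp F).

End support.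

(* Main.v *)
Require Import Defs.
From mathcomp Require Import all_boot all_order all_algebra.
From mathcomp Require Import all_classical all_reals all_analysis.
From mathcomp Require Import measurable_realfun ring lra.

Set Implicit Arguments.
Unset Strict Implicit.
Unset Printing Implicit Defensive.

Import Order.TTheory GRing.Theory Num.Theory.
Import numFieldNormedType.Exports.

Local Open Scope classical_set_scope.
Local Open Scope ring_scope.

(* Perturbing F towards an arbitrary H in an equilibrium (F, p) gives the
   first-order condition  \int (a - c_F) dH <= \int (a - c_F) dF =: M,  where
   a(q) = a_{F,p}(q; p).  Dirac masses H yield a - c_F <= M on [0,1], so equality
   holds dF-almost everywhere.  Since 0 <= a <= p, this puts c_F in [-M, p - M] on
   the support of dF by continuity of c_F, hence c_F oscillates
   by at most p on the support, and this tends to 0 with p. *)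

(** * Stieltjes measures of cdfs on [0,1]: total mass, mixtures, point masses *)

Section dcdf_theory.
Context {R : realType}.
Implicit Types (F H : cdf01 R) (f : R -> R).

Lemma dcdf_Nyc F (x : R) : dcdf F `]-oo, x]%classic = (F x)%:E.
Proof.
rewrite -(cdf_lebesgue_stieltjes_id F x) /cdf /distribution /=.
by rewrite /pushforward/= preimage_id.
Qed.

Lemma dcdf_itv F (a b : R) : a <= b ->
  dcdf F `]a, b]%classic = (F b - F a)%:E.
Proof.
move=> ab; rewrite /dcdf /lebesgue_stieltjes_measure /measure_extension.
rewrite [LHS]measurable_mu_extE/= ?wlength_itv_bnd//; exact: is_ocitv.
Qed.

(** The half-line is open because [F] may have an atom at 0. It is exhausted by closed half-lines
    ending at -1/(n+1), where [F] vanishes. *)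
Lemma dcdf_Nyo0 F : dcdf F `]-oo, 0[%classic = 0%E.
Proof.
apply: (measure_negligible (mu := dcdf F)); first by [].
have -> : `]-oo, (0 : R)[%classic = \bigcup_n `]-oo, - n.+1%:R^-1]%classic.
  apply/seteqP; split=> [x/=|x [n _]/=]; rewrite !in_itv/=; last first.
    by move=> /le_lt_trans; apply; rewrite oppr_lt0.
  move=> x0; exists (Num.truncn (- x)^-1) => //=; rewrite in_itv/=.
  rewrite lerNr -[leRHS]invrK lef_pV2 ?posrE ?invr_gt0 ?oppr_gt0//.
  by rewrite ltW// Num.Theory.truncnS_gt.
apply: negligible_bigcup => n; apply/negligibleP; first by [].
by rewrite [LHS]dcdf_Nyc cdf01_lt0// oppr_lt0.
Qed.

Lemma dcdf_gt1 F : dcdf F `]1, +oo[%classic = 0%E.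
Proof.
rewrite -setCitvl [LHS]probability_setC//.
by rewrite dcdf_Nyc cdf01_ge1// subee.
Qed.

(** Both tails are null. This links [supp], defined by masses of open sets of the whole line, with
    [int01], which integrates over [0,1] only. *)
Lemma dcdf_setI_unit F (U : set R) : measurable U ->
  dcdf F (U `&` `[0, 1]%classic) = dcdf F U.
Proof.
move=> mU.
have cX0 : dcdf F (~` `[(0 : R), 1]%classic) = 0%E.
  by rewrite setCitv measureU0//= ?dcdf_gt1// dcdf_Nyo0.
apply/esym; rewrite [LHS](measureDI (dcdf F) mU (measurable_itv `[(0 : R), 1])).
rewrite [X in (X + _)%E](subset_measure0 _ _ _ cX0) ?add0e//.
- by apply: measurableD.
- by apply: measurableC.
Qed.

Lemma dcdf_unit F : dcdf F `[0, 1]%classic = 1%E.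
Proof.
by rewrite -[X in dcdf _ X]setTI dcdf_setI_unit// probability_setT.
Qed.

Lemma bounded_int01_integrable F f (b : R) :
  measurable_fun `[(0 : R), 1]%classic f ->
  (forall x, x \in `[0, 1] -> `|f x| <= b) ->
  (dcdf F).-integrable `[(0 : R), 1]%classic (EFin \o f).
Proof.
move=> mf fb; apply: measurable_bounded_integrable => //.
  by rewrite [ltLHS]dcdf_unit ltry.
exists b; split => [|M bM]; first exact: num_real.
move=> x xX /=.
by rewrite (le_trans _ (ltW bM))// fb.
Qed.

(** The weighted sum [m] of the two measures agrees with [dcdf (mix F H t)] on half-open intervals,
    and these determine a Stieltjes measure. *)
Lemma dcdf_mix F H (t : R) A : 0 <= t <= 1 -> measurable A ->
  dcdf (mix F H t) A = ((1 - t)%:E * dcdf F A + t%:E * dcdf H A)%E.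
Proof.
move=> /andP[t0 t1] mA.
have s0 : 0 <= 1 - t by rewrite subr_ge0.
pose m := measure_add (mscale (NngNum s0) (dcdf F)) (mscale (NngNum t0) (dcdf H)).
suff mE : forall X, ocitv X -> dcdf (mix F H t) X = m X.
  apply: etrans (lebesgue_stieltjes_measure_unique mE mA) _.
  by rewrite [LHS]measure_addE.
move=> _ [[u v] _ <-]/=.
have [vu|/ltW uv] := leP v u.
  by rewrite set_itv_ge ?measure0// bnd_simp -leNgt.
apply: etrans (dcdf_itv _ uv) _; apply/esym.
apply: etrans (measure_addE _ _ _) _; rewrite /mscale/=.
have E K := dcdf_itv K uv; rewrite [X in (_ * X + _)%E]E [X in (_ + _ * X)%E]E.
rewrite -!EFinM -EFinD; congr EFin.
(* For t in [0,1] the projection inside [mix_weight] does nothing. *)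
have wt : mix_weight t = t by rewrite /mix_weight min_r// max_r.
by rewrite /= /mix_fun wt; ring.
Qed.

(** This makes the gross payoff affine in a firm's own distribution. Nonnegativity gives additivity
    in the measure, and the bound [b] keeps both integrals finite, so that [fine] commutes with the
    sum. *)
Lemma int01_mix F H f (b t : R) : 0 <= t <= 1 ->
  measurable_fun `[(0 : R), 1]%classic f ->
  (forall x, x \in `[0, 1] -> 0 <= f x <= b) ->
  int01 (mix F H t) f = (1 - t) * int01 F f + t * int01 H f.
Proof.
move=> t01 mf fb; have /andP[t0 t1] := t01.
have s0 : 0 <= 1 - t by rewrite subr_ge0.
have fi K : (dcdf K).-integrable `[(0 : R), 1]%classic (EFin \o f).
  apply: (@bounded_int01_integrable _ _ b) => // x /fb /andP[? ?].
  by rewrite ger0_norm.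
have f0 x : `[0, 1]%classic x -> (0 <= (f x)%:E)%E.
  by rewrite lee_fin => /fb /andP[].
have mEf : measurable_fun `[(0 : R), 1]%classic (EFin \o f) by exact/measurable_EFinP.
rewrite /int01 /Rintegral.
rewrite (eq_measure_integral (measure_add (mscale (NngNum s0) (dcdf F))
  (mscale (NngNum t0) (dcdf H)))); last first.
  move=> A mA _; apply: etrans (dcdf_mix _ _ t01 mA) _.
  by apply/esym; apply: etrans (measure_addE _ _ _) _.
rewrite ge0_integral_measure_add// !ge0_integral_mscale//.
rewrite fineD ?fin_numM ?(integrable_fin_num _ (fi _))//.
by rewrite !fineM// ?(integrable_fin_num _ (fi _)).
Qed.

Section dirac.
Variables (x : R) (x01 : x \in `[0, 1]).

Definition dirac_fun (y : R) : R := (x <= y)%R%:R.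

Lemma dirac_nd : nondecreasing dirac_fun.
Proof.
by move=> y z yz; rewrite /dirac_fun ler_nat; case: leP => //= /le_trans ->.
Qed.

Lemma dirac_rc : right_continuous dirac_fun.
Proof.
move=> y; apply: cvg_near_cst; rewrite /dirac_fun.
have [xy|yx] := leP x y; near=> z.
  by rewrite (le_trans xy)//; near: z; exact: nbhs_right_ge.
by rewrite leNgt; suff -> : z < x by []; near: z; exact: nbhs_right_lt.
Unshelve. all: by end_near. Qed.

Lemma dirac_lt0 y : y < 0 -> dirac_fun y = 0.
Proof.
move: x01; rewrite in_itv/= => /andP[x0 _] y0.
by rewrite /dirac_fun leNgt (lt_le_trans y0).
Qed.

Lemma dirac_ge1 y : 1 <= y -> dirac_fun y = 1.
Proof.
move: x01; rewrite in_itv/= => /andP[_ x1] y1.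
by rewrite /dirac_fun (le_trans x1).
Qed.

Definition dirac01 : cdf01 R := Cdf01 dirac_nd dirac_rc dirac_lt0 dirac_ge1.

(** The Stieltjes measure of [dirac01] and the Dirac measure coincide on half-open intervals, hence
    everywhere. Point masses turn the integral first-order condition into a pointwise one. *)
Lemma int01_dirac f : measurable_fun `[(0 : R), 1]%classic f -> int01 dirac01 f = f x.
Proof.
move=> mf; rewrite /int01 /Rintegral.
have -> : (\int[dcdf dirac01]_(y in `[0%R, 1%R]) (f y)%:E =
  \int[\d_(x : measurableTypeR R)]_(y in `[0%R, 1%R]) (f y)%:E)%E.
  apply: eq_measure_integral => A mA _.
  apply: lebesgue_stieltjes_measure_unique mA => _ [[u v] _ <-]/=.
  have [vu|uv] := leP v u.
    by rewrite set_itv_ge ?measure0// bnd_simp -leNgt.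
  apply: etrans (dcdf_itv _ (ltW uv)) _; rewrite diracE mem_setE in_itv/= /dirac_fun.
  by case: (leP x u) => [xu|ux]; [rewrite (le_trans xu (ltW uv)) subrr| rewrite subr0].
rewrite integral_dirac//; last exact/measurable_EFinP.
by rewrite diracE mem_setE x01 mul1e.
Qed.

End dirac.

End dcdf_theory.

(** * The support of dF and its end points *)

Section support_theory.
Context {R : realType}.
Implicit Types F : cdf01 R.

Lemma supp_sub F : supp F `<=` `[0, 1]%classic.
Proof.
move=> x Fx; apply: contrapT => xX.
have oU : open (~` `[(0 : R), 1]%classic) by exact/closed_openC/itv_closed.
have := Fx _ oU xX; rewrite -dcdf_setI_unit; last exact: open_measurable.
by rewrite setICl measure0 ltxx.
Qed.

Lemma supp_neq0 F : supp F !=set0.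
Proof.
(* The infimum of the positivity set of F is the left end of the support. *)
pose A := [set x | 0 < F x].
have iA : has_inf A.
  split; first by exists 1; rewrite /A/= cdf01_ge1.
  exists 0 => x; rewrite /A/= leNgt; apply: contraPN => x0.
  by rewrite cdf01_lt0// ltxx.
exists (inf A) => U oU UA.
have /nbhs_ballP[e /= e0 eU] := open_nbhs_nbhs (conj oU UA).
have e20 : 0 < e / 2 by rewrite divr_gt0.
have [y Ay ye] := inf_adherent e20 iA.
have Fl : F (inf A - e / 2) <= 0.
  rewrite leNgt; apply/negP => /(ge_inf iA.2); lra.
have Fr : 0 < F (inf A + e / 2) by rewrite (lt_le_trans Ay)// cdf01_nd// ltW.
have IU : `]inf A - e / 2, inf A + e / 2]%classic `<=` U.
  move=> z /=; rewrite in_itv/= => /andP[lz zr]; apply: eU.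
  by rewrite /ball/= ltr_norml; apply/andP; split; lra.
have mU : measurable U by exact: open_measurable.
apply: lt_le_trans (le_measure (dcdf F) _ _ IU); rewrite ?inE//.
rewrite [ltRHS]dcdf_itv; last by lra.
by rewrite lte_fin subr_gt0 (le_lt_trans Fl).
Qed.

Lemma has_sup_supp F : has_sup (supp F).
Proof.
split; first exact: supp_neq0.
by exists 1 => x /supp_sub /=; rewrite in_itv/= => /andP[].
Qed.

Lemma has_inf_supp F : has_inf (supp F).
Proof.
split; first exact: supp_neq0.
by exists 0 => x /supp_sub /=; rewrite in_itv/= => /andP[].
Qed.

(** The support is closed: an open set around its supremum meets it, and so has positive mass. *)
Lemma supp_high_mem F : supp F (supp_high F).
Proof.
move=> U oU Us; have [S0 Sub] := has_sup_supp F.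
have [x [Fx Ux]] := closure_sup S0 Sub (open_nbhs_nbhs (conj oU Us)).
exact: Fx.
Qed.

Lemma supp_low_mem F : supp F (supp_low F).
Proof.
move=> U oU Us.
have /nbhs_ballP[e /= e0 eU] := open_nbhs_nbhs (conj oU Us).
have [x Fx xe] := inf_adherent e0 (has_inf_supp F).
have lx : supp_low F <= x by apply: ge_inf => //; exact: (has_inf_supp F).2.
apply: Fx => //; apply: eU; rewrite /ball/= ler0_norm ?subr_le0//.
by rewrite opprB ltrBlDl.
Qed.

(** [h] dominates [d] times the indicator of a neighbourhood of [x], which has positive mass.
    Contrapositively, a nonnegative function with zero integral cannot stay above a positive
    constant near a support point. *)
Lemma int01_supp_gt0 F (h : R -> R) (x d : R) :
  (dcdf F).-integrable `[(0 : R), 1]%classic (EFin \o h) ->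
  (forall y, y \in `[0, 1] -> 0 <= h y) ->
  0 < d -> (\forall y \near x, y \in `[0, 1] -> d <= h y) ->
  supp F x -> 0 < int01 F h.
Proof.
move=> hi h0 d0 hd Fx.
(* The implication holds vacuously off [0,1], so [U] is open in the line and contains [x] even if
   [x] is 0 or 1. *)
pose U : set R := [set y | y \in `[0, 1] -> d <= h y]°.
have oU : open U by exact: open_interior.
have mU : measurable U by exact: open_measurable.
have i1 : (dcdf F).-integrable `[(0 : R), 1]%classic (EFin \o (fun y => d * \1_U y)).
  apply: (@bounded_int01_integrable _ _ _ d).
    by apply: measurable_funM => //; exact: measurable_indic.
  move=> y _; rewrite normrM (gtr0_norm d0) ger_pMr//.
  by rewrite indicE; case: (y \in U); rewrite ?normr1 ?normr0.
have i2 : (dcdf F).-integrable `[(0 : R), 1]%classic (EFin \o \1_U).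
  apply: (@bounded_int01_integrable _ _ _ 1); first exact: measurable_indic.
  by move=> y _; rewrite indicE; case: (y \in U); rewrite ?normr1 ?normr0.
apply: (@lt_le_trans _ _ (int01 F (fun y => d * \1_U y))); last first.
  apply: le_Rintegral => // y yX; rewrite indicE.
  have [yU|_] := boolP (y \in U); last by rewrite mulr0 h0.
  by rewrite mulr1; move: yU; rewrite inE => /interior_subset; exact.
rewrite /int01 RintegralZl// mulr_gt0// /Rintegral.
rewrite integral_indic// [X in fine X]dcdf_setI_unit//.
by rewrite fine_gt0// Fx//= ltey_eq fin_num_measure.
Qed.

End support_theory.

(** * Bounds on sales, the first-order condition, and costs on the support *)

Section game_theory.
Context {R : realType}.
Variables (sigma : R) (G : cdf01 R).
Implicit Types F H : cdf01 R.

Lemma hatF_ge0 F z : 0 <= hatF sigma G F z.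
Proof. by rewrite fine_ge0// cdf_ge0. Qed.

Lemma hatF_le1 F z : hatF sigma G F z <= 1.
Proof.
have c1 := cdf_le1 (perceived sigma : {RV (dcdf F \x dcdf G)%E >-> R}) z.
by rewrite -lee_fin fineK// fin_num_measure.
Qed.

Lemma hatF_nd F : {homo hatF sigma G F : x y / x <= y}.
Proof.
move=> x y xy; rewrite fine_le ?fin_num_measure//.
exact: cdf_nondecreasing.
Qed.

Hypothesis sigma01 : 0 < sigma < 1.

(** The integrand is nondecreasing in [e] since [sigma] is positive, hence measurable, and its
    values lie in [0,1]. *)
Lemma demand_integrable F n (p q r : R) :
  (dcdf G).-integrable `[(0 : R), 1]%classic
    (EFin \o (fun e => hatF sigma G F ((1 - sigma) * q + sigma * e + p - r) ^+ n)).
Proof.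
have /andP[s0 _] := sigma01.
apply: (@bounded_int01_integrable _ _ _ 1).
  apply: nondecreasing_measurable => // x y xy.
  rewrite lerXn2r ?nnegrE ?hatF_ge0// hatF_nd// !lerD2r lerD2l.
  by rewrite ler_wpM2l// ltW.
by move=> e _; rewrite ger0_norm ?exprn_ge0 ?exprn_ile1 ?hatF_ge0 ?hatF_le1.
Qed.

Lemma sale_value_ge0 n F p q r : 0 <= r -> 0 <= sale_value sigma G n F p q r.
Proof.
move=> r0; rewrite mulr_ge0// Rintegral_ge0// => e _.
by rewrite exprn_ge0// hatF_ge0.
Qed.

Lemma sale_value_le n F p q r : 0 <= r -> sale_value sigma G n F p q r <= r.
Proof.
move=> r0; rewrite ler_piMr//.
have i1 : int01 G (cst 1) = 1.
  by rewrite /int01 Rintegral_cst// mul1r [X in fine X]dcdf_unit.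
rewrite -[leRHS]i1; apply: le_Rintegral => //.
- exact: demand_integrable.
- apply: (@bounded_int01_integrable _ _ _ 1) => //.
  by move=> x _; rewrite normr1.
- by move=> e _; rewrite exprn_ile1 ?hatF_ge0 ?hatF_le1.
Qed.

(** Higher quality sells more, as 1 - [sigma] is positive; measurability in [q] is deduced from this
    monotonicity. *)
Lemma sale_value_nd n F p r : 0 <= r ->
  {homo (fun q => sale_value sigma G n F p q r) : x y / x <= y}.
Proof.
move=> r0 x y xy; rewrite /sale_value.
apply: ler_wpM2l; first exact: r0.
apply: le_Rintegral; first exact: measurable_itv.
- exact: demand_integrable.
- exact: demand_integrable.
- move=> e _; rewrite lerXn2r ?nnegrE ?hatF_ge0// hatF_nd// !lerD2r.
  by rewrite ler_wpM2l// subr_ge0 ltW//; case/andP: sigma01.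
Qed.

Lemma sale_value_measurable n F p r (D : set R) : 0 <= r -> measurable D ->
  measurable_fun D (fun q => sale_value sigma G n F p q r).
Proof.
move=> r0 mD; apply: nondecreasing_measurable; first exact: mD.
exact: sale_value_nd r0.
Qed.

Lemma sale_value_integrable n F p r H : 0 <= r ->
  (dcdf H).-integrable `[(0 : R), 1]%classic
    (EFin \o (fun q => sale_value sigma G n F p q r)).
Proof.
move=> r0; apply: (@bounded_int01_integrable _ _ _ r).
  exact: sale_value_measurable r0 (measurable_itv _).
by move=> q _; rewrite ger0_norm ?sale_value_ge0// sale_value_le.
Qed.

Variables (pbar : R) (C : cdf01 R -> R) (c : cdf01 R -> R -> R).
Hypothesis C_gateaux : cost_gateaux C c.

(** Deviate to [mix F H e] at the unchanged price [p]. The gross gain is exactly [e] times the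
    left-hand side, so that side is at most the difference quotient of [C]; then [e] tends to 0. *)
Lemma equilibrium_foc n F p H :
  symmetric_equilibrium sigma G pbar C n F p ->
  int01 H (fun q => sale_value sigma G n F p q p) -
    int01 F (fun q => sale_value sigma G n F p q p)
  <= int01 H (c F) - int01 F (c F).
Proof.
case=> pP eqF; have p0 : 0 <= p by move: pP; rewrite in_itv/= => /andP[].
apply: (cvgr_to_ge ((C_gateaux F).2 H)); near=> e.
have e0 : 0 < e by near: e; exact: nbhs_right_gt.
have e1 : e <= 1 by near: e; exact: nbhs_right_le.
have := eqF (mix F H e) _ pP; rewrite /payoff.
rewrite (@int01_mix _ _ _ _ p) ?(ltW e0)//.
- by rewrite ler_pdivlMl//; lra.
- exact: sale_value_measurable p0 (measurable_itv _).
- by move=> q _; rewrite sale_value_ge0// sale_value_le.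
Unshelve. all: by end_near. Qed.

Lemma continuous_unit_integrable F (f : R -> R) :
  {within `[(0 : R), 1]%classic, continuous f} ->
  (dcdf F).-integrable `[(0 : R), 1]%classic (EFin \o f).
Proof.
move=> fc.
have [M _ fM] := EVT_max ler01 fc.
have [m _ fm] := EVT_min ler01 fc.
apply: (@bounded_int01_integrable _ _ _ (`|f M| + `|f m|)).
  exact: subspace_continuous_measurable_fun.
move=> x xX; have := fM _ xX; have := fm _ xX.
have := ler_norm (f M); have := ler_norm (- f m); rewrite normrN.
have := normr_ge0 (f M); have := normr_ge0 (f m).
by rewrite ler_norml => *; apply/andP; split; lra.
Qed.

Lemma equilibrium_supp_cost n F p :
  symmetric_equilibrium sigma G pbar C n F p ->
  {in supp F &, forall x y, c F x - c F y <= p}.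
Proof.
move=> eqF; have p0 : 0 <= p by case: eqF; rewrite in_itv/= => /andP[].
pose a q := sale_value sigma G n F p q p.
have ai : (dcdf F).-integrable `[(0 : R), 1]%classic (EFin \o a).
  exact: sale_value_integrable.
have cc := (C_gateaux F).1; have ci := continuous_unit_integrable F cc.
(* The dF-average of a - c_F, which the Dirac deviations show to be also an upper bound of a - c_F
   on [0,1]. *)
pose M := int01 F a - int01 F (c F).
have foc q : q \in `[0, 1] -> a q - M <= c F q.
  move=> qX; have := equilibrium_foc (dirac01 qX) eqF.
  rewrite !int01_dirac//.
  - by rewrite /M /a; lra.
  - exact: subspace_continuous_measurable_fun.
  - exact: sale_value_measurable p0 (measurable_itv _).
move=> x y; rewrite !inE => Fx Fy.
have cy : - M <= c F y.
  have yX := supp_sub Fy.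
  have := foc _ yX; have := sale_value_ge0 n F p y p0; rewrite -/(a y); lra.
suff cx : c F x <= p - M by lra.
rewrite leNgt; apply/negP => cx.
(* Half of the assumed excess is spent on the variation of [c F] near [x]. Since [a] is at most [p],
   the other half remains as a lower bound for the slack [h]. *)
pose d := (c F x - (p - M)) / 2.
pose h q := c F q - a q + M.
have Mi : (dcdf F).-integrable `[(0 : R), 1]%classic (EFin \o cst M).
  exact: (@bounded_int01_integrable _ _ _ `|M|).
have cai : (dcdf F).-integrable `[(0 : R), 1]%classic (EFin \o (fun q => c F q - a q)).
  exact: (@integrableB _ (measurableTypeR R) _ (dcdf F) _ (measurable_itv _) _ _ ci ai).
(* The integral of [h] is zero by the choice of [M], since dF has mass 1 on [0,1]. *)
suff : 0 < int01 F h.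
  rewrite /int01 RintegralD// RintegralB// Rintegral_cst//.
  rewrite [X in _ * fine X]dcdf_unit mulr1 -/(int01 F (c F)) -/(int01 F a).
  by rewrite /M; lra.
apply: (@int01_supp_gt0 _ _ _ x d) => //.
- exact: (@integrableD _ (measurableTypeR R) _ (dcdf F) _ (measurable_itv _) _ _ cai Mi).
- by move=> q /foc; rewrite /h; lra.
- by rewrite /d; lra.
- have xX := supp_sub Fx.
  (* Continuity of [c F] is relative to [0,1], which matches the restricted neighbourhood condition
     of [int01_supp_gt0]. *)
  have /cvgr_gt/(_ (c F x - d)) := (subspace_continuousP _ _).1 cc x xX.
  have -> : c F x - d < c F x by rewrite /d; lra.
  move=> /(_ isT); rewrite near_withinE; apply: filterS => q qd qX.
  have : c F x - d < c F q := qd qX; have := sale_value_le n F p q p0.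
  by rewrite /h -/(a q) /d; lra.
Qed.

End game_theory.

Theorem corollary6p4 (R : realType) (sigma pbar : R) (G : cdf01 R)
    (C : cdf01 R -> R) (c : cdf01 R -> R -> R)
    (F : nat -> cdf01 R) (p : nat -> R)
    (sigma01 : 0 < sigma < 1) (pbar_gt0 : 0 < pbar)
    (G_density : has_continuous_density G)
    (C_convex : cost_convex C) (C_continuous : continuous C)
    (C_gateaux : cost_gateaux C c) (c_steep : cost_steep c pbar)
    (Fp_eq : forall n, (2 <= n)%N ->
      symmetric_equilibrium sigma G pbar C n (F n) (p n)) :
  (p n @[n --> \oo] --> (0 : R) ->
    c (F n) (supp_high (F n)) - c (F n) (supp_low (F n))
      @[n --> \oo] --> (0 : R)) /\
  ((exists2 kappa : R, 0 < kappa &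
      forall (H : cdf01 R) (x y : R), 0 <= x -> x < y -> y <= 1 ->
        kappa * (y - x) <= c H y - c H x) ->
    p n @[n --> \oo] --> (0 : R) ->
    supp_high (F n) - supp_low (F n) @[n --> \oo] --> (0 : R)).
Proof.
(* Both end points belong to the support, so the oscillation bound applies to them in either
   order. *)
have bound n : (2 <= n)%N ->
    - p n <= c (F n) (supp_high (F n)) - c (F n) (supp_low (F n)) <= p n.
  move=> n2; have lo := mem_set (@supp_low_mem _ (F n)).
  have hi := mem_set (@supp_high_mem _ (F n)).
  have cost := equilibrium_supp_cost sigma01 C_gateaux (Fp_eq _ n2).
  have := cost _ _ hi lo; have := cost _ _ lo hi.
  by move=> *; apply/andP; split; lra.
split=> [p_cvg|[k k0 ck] p_cvg].
  have Np_cvg : - p n @[n --> \oo] --> (0 : R) by rewrite -oppr0; exact: cvgN.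
  apply: (squeeze_cvgr _ Np_cvg p_cvg).
  by near=> n; apply: bound; near: n; exact: nbhs_infty_ge.
have cvg_pk : k^-1 * p n @[n --> \oo] --> (0 : R).
  by rewrite -(mulr0 k^-1); exact: cvgMl_tmp.
apply: (squeeze_cvgr _ (cvg_cst 0) cvg_pk); near=> n.
have /bound /andP[_ cp] : (2 <= n)%N by near: n; exact: nbhs_infty_ge.
have lh : supp_low (F n) <= supp_high (F n).
  by apply: ub_le_sup (@supp_low_mem _ (F n)); exact: (has_sup_supp _).2.
rewrite subr_ge0 lh/= ler_pdivlMl// (le_trans _ cp)//.
(* The slope condition concerns distinct points, so a one-point support is treated apart. *)
have := lh; rewrite le_eqVlt => /predU1P[->|lt_lh]; first by rewrite !subrr mulr0.
have /andP[l0 _] := supp_sub (@supp_low_mem _ (F n)).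
have /andP[_ h1] := supp_sub (@supp_high_mem _ (F n)).
exact: ck.
Unshelve. all: by end_near. Qed.
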